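(* There exists $n_0$ such that for every integer $n\geq n_0$ the following holds. In the Waiter-Client game on $K_n$, Client has a strategy ensuring that at the end of the game his red graph does not contain two vertex-disjoint stars each having at least $0.499n$ edges.
   Context: In the unbiased Waiter-Client game on $K_n$, the board is the edge set of the complete graph $K_n$. In each round Waiter offers Client two previously unclaimed edges; Client chooses one of them, which he keeps (colored red), and the other goes to Waiter (colored blue). If in the final round only one unclaimed edge remains, it goes to Waiter. *)

(* Defs.v *)
From mathcomp Require Import all_boot.
Set Implicit Arguments. Unset Strict Implicit. Unset Printing Implicit Defensive.

Definition Kedges (n : nat) : {set {set 'I_n}} := [set e : {set 'I_n} | #|e| == 2].

(* Unbiased Waiter-Client game.  A position is (R, U): R = Client's (red)
   edges so far, U = unclaimed edges.  [client_wins P R U] holds iff Client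
   has a strategy from position (R, U) guaranteeing that his final red graph
   satisfies P.  In each round (while at least 2 edges are unclaimed) Waiter
   offers two distinct unclaimed edges e1 e2; Client keeps one (red), the
   other goes to Waiter.  When at most one unclaimed edge remains the game
   ends (a single remaining edge goes to Waiter, so the red graph is R). *)
Inductive client_wins (n : nat) (P : {set {set 'I_n}} -> Prop)
  : {set {set 'I_n}} -> {set {set 'I_n}} -> Prop :=
| cw_end (R U : {set {set 'I_n}}) :
    #|U| <= 1 -> P R -> client_wins P R U
| cw_step (R U : {set {set 'I_n}}) :
    1 < #|U| ->
    (forall e1 e2, e1 \in U -> e2 \in U -> e1 != e2 ->
       client_wins P (e1 |: R) (U :\ e1 :\ e2) \/
       client_wins P (e2 |: R) (U :\ e1 :\ e2)) ->
    client_wins P R U.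

Definition has_star (n : nat) (G : {set {set 'I_n}}) (c : 'I_n) (L : {set 'I_n}) : Prop :=
  forall l, l \in L -> [set c; l] \in G.

Definition two_disjoint_big_stars (n : nat) (G : {set {set 'I_n}}) : Prop :=
  exists (c1 c2 : 'I_n) (L1 L2 : {set 'I_n}),
    [/\ has_star G c1 L1, has_star G c2 L2,
        [disjoint (c1 |: L1) & (c2 |: L2)],
        499 * n <= 1000 * #|L1| & 499 * n <= 1000 * #|L2|].

(* Main.v *)
(* Let Client be slightly random: he keeps the offered edge of smaller vertex
   sum with probability 2/3.  Fix two centres a < b.  If Waiter offers {a,v}
   and {b,v} in the same round, a is favoured over b, so doing this for most v
   starves b; if he offers them in different rounds, then with probability at
   least 1/9 neither becomes red, so doing this for many v leaves too many
   vertices uncovered by the two stars.  A single per-vertex score captures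
   both effects: it is a supermartingale with bounded increments whatever
   Waiter does, while two big disjoint stars at a and b force it up by a
   constant times n.  Exponentiating the score, with a factor > 1 for every
   unclaimed edge at a or b to pay for the second-order terms, and summing over
   all pairs a < b gives a potential; keeping it from increasing derandomizes
   the strategy. *)
Require Import Defs.
From mathcomp Require Import all_boot.
From mathcomp Require Import all_order all_algebra.
From mathcomp Require Import zify ring lra.
Import Order.TTheory GRing.Theory Num.Theory.
Local Open Scope ring_scope.

(* (u, d): factors by which one vertex weight changes when an edge at it turns
   red, respectively blue.  The score goes up by c or down by 2c, so it has no
   drift at the largest red probability, 2/3.  The case (1, 1) stands for an
   edge that is not at either centre. *)
Definition ratio_pair (F : realFieldType) (x y u d : F) : Prop :=
  (u = 1 /\ d = 1) \/
  exists2 c : nat, (c <= 4)%N & u = x ^+ c / y /\ d = (x ^+ (2 * c))^-1 / y.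

(** Bernoulli gives [z ^+ k >= k * h] for [k = n %/ d.+1]; its power [d.+1] grows like [n ^ d.+1],
    one degree more than needed. *)
Lemma expn_lt_expr (F : archiRealFieldType) (z : F) (d : nat) : 1 < z ->
  exists N, forall n, (N <= n)%N -> (n ^ d)%:R < z ^+ n.
Proof.
move=> z1; pose h := z - 1; have h0 : 0 < h by rewrite subr_gt0.
pose C : F := (2 * d.+1)%:R ^+ d / h ^+ d.+1.
have C0 : 0 <= C by rewrite divr_ge0 ?exprn_ge0 ?(ltW h0).
exists (d.+1 * (Num.bound C).+1)%N => n leNn; pose k := (n %/ d.+1)%N.
have lek : ((Num.bound C).+1 <= k)%N by rewrite leq_divRL // mulnC.
have lenk : (n <= 2 * d.+1 * k)%N.
  rewrite (divn_eq n d.+1) -/k.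
  have := ltn_pmod n (ltn0Sn d); nia.
have bern : k%:R * h <= z ^+ k.
  elim: (k) => [|j IH]; first by rewrite mul0r expr0.
  have zj : 1 <= z ^+ j by rewrite exprn_ege1 // ltW.
  rewrite exprSr -natr1 mulrDl mul1r.
  have -> : z ^+ j * z = z ^+ j + z ^+ j * h by rewrite /h; ring.
  by rewrite lerD // ler_peMl // ltW.
have k0 : 0 < k%:R :> F by rewrite ltr0n; apply: leq_trans lek.
apply: (@lt_le_trans _ _ ((k%:R * h) ^+ d.+1)); last first.
  apply: (@le_trans _ _ ((z ^+ k) ^+ d.+1)).
    apply: lerXn2r => //; rewrite nnegrE ?mulr_ge0 ?exprn_ge0 // ltW //.
    exact: lt_trans ltr01 z1.
  by rewrite -exprM; apply: ler_weXn2l; rewrite ?(ltW z1) // leq_divM.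
apply: (@le_lt_trans _ _ (((2 * d.+1) * k) ^ d)%:R).
  by rewrite natrX [leRHS]natrX lerXn2r ?nnegrE ?ler0n ?ler_nat.
rewrite natrX natrM !exprMn (exprS k%:R) mulrAC ltr_pM2r ?exprn_gt0 //.
rewrite -ltr_pdivrMr ?exprn_gt0 //; apply: lt_trans (archi_boundP C0) _.
by rewrite ltr_nat.
Qed.

(** * Weights of a single vertex and their changes *)

Section Potential.
Variables (F : archiRealFieldType) (base tax : F).
Hypotheses (base_gt1 : 1 < base) (tax_gt1 : 1 < tax).
Local Notation ratio_pair := (ratio_pair F base tax).
(** Case of two offered edges that are not spokes at the same vertex. With probability 2/3 the first
    is red and the second blue ([u * d']), otherwise the reverse ([d * u']); the mean factor must be
    at most 1. *)
Hypothesis ratio_pair_drift : forall u d u' d' : F,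
  ratio_pair u d -> ratio_pair u' d' -> 2%:R * (u * d') + d * u' <= 3%:R.
(** Case of {a,v} and {b,v} offered together. The score 10 becomes 9 with probability 2/3 and 12
    otherwise, so its mean stays 10; the two released factors [tax] absorb the convexity error. *)
Hypothesis shared_drift :
  2%:R * base ^+ 9 + base ^+ 12 <= 3%:R * (base ^+ 10 * tax ^+ 2).

Lemma base_gt0 : 0 < base. Proof. exact: lt_trans ltr01 base_gt1. Qed.
Lemma tax_gt0 : 0 < tax. Proof. exact: lt_trans ltr01 tax_gt1. Qed.

(* ra, ua: whether {a,v} is red, unclaimed; rb, ub: the same for {b,v}.  When
   both are claimed the values are those of the potential at the end of the
   game; the others are the values of the remaining game in which every red
   probability is at most 2/3. *)
Definition score (ra ua rb ub : bool) : nat :=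
  match ua, ub with
  | true, true => 10
  | true, false => if rb then 12 else 6
  | false, true => if ra then 11 else 8
  | false, false => if rb then 12 else if ra then 9 else 0
  end.

Definition weight (ra ua rb ub : bool) : F :=
  base ^+ score ra ua rb ub * tax ^+ (ua + ub).

Lemma weight_gt0 (ra ua rb ub : bool) : 0 < weight ra ua rb ub.
Proof.
by apply: mulr_gt0; apply: exprn_gt0; [exact: base_gt0 | exact: tax_gt0].
Qed.

Lemma ratio_pair_shift (c s r b k : nat) : (c <= 4)%N ->
  r = (s + c)%N -> s = (b + 2 * c)%N ->
  exists u d, [/\ ratio_pair u d,
    base ^+ r * tax ^+ k = u * (base ^+ s * tax ^+ k.+1) &
    base ^+ b * tax ^+ k = d * (base ^+ s * tax ^+ k.+1)].
Proof.
have base_neq0 := lt0r_neq0 base_gt0; have tax_neq0 := lt0r_neq0 tax_gt0.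
move=> c4 -> Es; exists (base ^+ c / tax), ((base ^+ (2 * c))^-1 / tax); split.
- by right; exists c.
- by rewrite exprD exprS; field.
- by rewrite Es (exprD _ b) exprS; field; rewrite tax_neq0 expf_neq0.
Qed.

Lemma weight_ratio_small (rb ub : bool) : exists u d, [/\ ratio_pair u d,
  weight true false rb ub = u * weight false true rb ub &
  weight false false rb ub = d * weight false true rb ub].
Proof.
rewrite /weight /= add0n add1n.
(* Score changes, red or blue: 10 to 11 or 8 while {b,v} is unclaimed; 12 stays 12 if {b,v} is red;
   6 to 9 or 0 if it is blue. *)
by case: ub rb => -[];
  [apply: (@ratio_pair_shift 1)|apply: (@ratio_pair_shift 1)
  |apply: (@ratio_pair_shift 0)|apply: (@ratio_pair_shift 3)].
Qed.

Lemma weight_ratio_large (ra ua : bool) : exists u d, [/\ ratio_pair u d,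
  weight ra ua true false = u * weight ra ua false true &
  weight ra ua false false = d * weight ra ua false true].
Proof.
rewrite /weight /= addn0 addn1.
(* Score changes, red or blue: 10 to 12 or 6 while {a,v} is unclaimed; 11 to 12 or 9 if {a,v} is
   red; 8 to 12 or 0 if it is blue. *)
by case: ua ra => -[];
  [apply: (@ratio_pair_shift 2)|apply: (@ratio_pair_shift 2)
  |apply: (@ratio_pair_shift 1)|apply: (@ratio_pair_shift 4)].
Qed.

(** * The potential of a fixed pair of centres *)

Section Pair.
Variables (n : nat) (a b : 'I_n).
Hypothesis neq_ab : a != b.
Implicit Types (R U : {set {set 'I_n}}) (e : {set 'I_n}) (v w : 'I_n).

Definition other v := (v != a) && (v != b).

Definition wt R U v : F :=
  weight ([set a; v] \in R) ([set a; v] \in U)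
         ([set b; v] \in R) ([set b; v] \in U).

Definition pot R U : F := \prod_(v | other v) wt R U v.

Definition touch e v := (e == [set a; v]) || (e == [set b; v]).

Lemma wt_gt0 R U v : 0 < wt R U v. Proof. exact: weight_gt0. Qed.

Lemma set2_injr (c v w : 'I_n) : c != v -> [set c; v] = [set c; w] -> v = w.
Proof.
move=> ncv E; have: v \in [set c; w] by rewrite -E set22.
by rewrite in_set2 eq_sym (negPf ncv) => /eqP.
Qed.

Lemma spokes_neq v w : other v -> other w -> [set a; v] != [set b; w].
Proof.
move=> /andP[_ _] /andP[wa _]; apply/eqP => E.
have: a \in [set b; w] by rewrite -E set21.
by rewrite in_set2 (negPf neq_ab) eq_sym (negPf wa).
Qed.

(** Ensures that claiming an edge changes at most one factor of [pot]. *)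
Lemma touch_inj e v w : other v -> other w -> touch e v -> touch e w -> v = w.
Proof.
move=> ov ow; have [/andP[va vb] _] := (ov, ow).
case/orP=> /eqP-> /orP[] /eqP E.
- by apply: (set2_injr _ _ _ _ E); rewrite eq_sym.
- by have := spokes_neq v w ov ow; rewrite E eqxx.
- by have := spokes_neq w v ow ov; rewrite E eqxx.
- by apply: (set2_injr _ _ _ _ E); rewrite eq_sym.
Qed.

Lemma wt_untouched R U e1 e2 e v : ~~ touch e1 v -> ~~ touch e2 v ->
  e \in [set e1; e2] -> wt (e |: R) (U :\ e1 :\ e2) v = wt R U v.
Proof.
rewrite /touch !negb_or => /andP[a1 b1] /andP[a2 b2].
rewrite in_set2 => /orP[] /eqP->;
  by rewrite /wt !inE !(eq_sym _ e1) !(eq_sym _ e2) a1 a2 b1 b2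
             ?(negPf a1) ?(negPf b1) ?(negPf a2) ?(negPf b2).
Qed.

Lemma wt_touched R U e1 e2 v : other v -> e1 \in U -> e1 \notin R ->
  touch e1 v -> ~~ touch e2 v ->
  exists u d, [/\ ratio_pair u d,
    wt (e1 |: R) (U :\ e1 :\ e2) v = u * wt R U v &
    wt (e2 |: R) (U :\ e1 :\ e2) v = d * wt R U v].
Proof.
move=> ov; have nab := spokes_neq v v ov ov; rewrite /touch negb_or => e1U e1R.
case/orP=> /eqP E1 /andP[a2 b2]; subst e1; rewrite /wt !inE !eqxx /=
  !(eq_sym _ e2) (negPf a2) (negPf b2) ?(eq_sym [set b; v] [set a; v])
  (negPf nab) /= (negPf e1R) e1U /=.
- exact: weight_ratio_small.
- exact: weight_ratio_large.
Qed.

Lemma wt_shared R U v : other v ->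
  [set a; v] \in U -> [set b; v] \in U -> [disjoint R & U] ->
  let U' := U :\ [set a; v] :\ [set b; v] in
  2%:R * wt ([set a; v] |: R) U' v + wt ([set b; v] |: R) U' v
    <= 3%:R * wt R U v.
Proof.
move=> ov aU bU dRU /=; have nab := spokes_neq v v ov ov.
have aR : [set a; v] \in R = false by rewrite (disjointFl dRU).
have bR : [set b; v] \in R = false by rewrite (disjointFl dRU).
rewrite /wt !inE !eqxx !(eq_sym [set b; v]) (negPf nab) aR bR aU bU /=.
by rewrite /weight /= !mulr1; exact: shared_drift.
Qed.

Lemma pot_drift0 R U e1 e2 :
  (forall v, other v -> ~~ touch e1 v && ~~ touch e2 v) ->
  2%:R * pot (e1 |: R) (U :\ e1 :\ e2) + pot (e2 |: R) (U :\ e1 :\ e2)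
    <= 3%:R * pot R U.
Proof.
move=> H; have E e : e \in [set e1; e2] ->
    pot (e |: R) (U :\ e1 :\ e2) = pot R U.
  by move=> He; apply: eq_bigr => v /H /andP[t1 t2]; exact: wt_untouched.
by rewrite !E ?set21 ?set22 //; lra.
Qed.

Lemma pot_touch1 R U e1 e2 v : other v -> e1 \in U -> e1 \notin R ->
  touch e1 v -> (forall w, other w -> ~~ touch e2 w) ->
  exists u d, [/\ ratio_pair u d,
    pot (e1 |: R) (U :\ e1 :\ e2) = u * pot R U &
    pot (e2 |: R) (U :\ e1 :\ e2) = d * pot R U].
Proof.
move=> ov e1U e1R t1 t2.
have [u [d [ud Eu Ed]]] := wt_touched R U e1 e2 v ov e1U e1R t1 (t2 _ ov).
exists u, d; rewrite /pot.
have E e : e \in [set e1; e2] ->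
    \prod_(w | other w && (w != v)) wt (e |: R) (U :\ e1 :\ e2) w =
    \prod_(w | other w && (w != v)) wt R U w.
  move=> He; apply: eq_bigr => w /andP[ow nwv]; apply: wt_untouched He.
    by apply: contra nwv => tw; rewrite (touch_inj _ _ _ ov ow t1 tw).
  exact: t2.
by rewrite !(bigD1 v ov) /= !E ?set21 ?set22 // Eu Ed !mulrA.
Qed.

Lemma pot_touch2 R U e1 e2 v w : other v -> other w ->
  e1 \in U -> e1 \notin R -> e2 \in U -> e2 \notin R ->
  v != w -> touch e1 v -> touch e2 w ->
  exists u d u' d', [/\ ratio_pair u d, ratio_pair u' d',
    pot (e1 |: R) (U :\ e1 :\ e2) = u * d' * pot R U &
    pot (e2 |: R) (U :\ e1 :\ e2) = d * u' * pot R U].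
Proof.
move=> ov ow e1U e1R e2U e2R nvw t1 t2.
have n2 z : other z -> z != w -> ~~ touch e2 z.
  by move=> oz; apply: contra => tz; rewrite (touch_inj _ _ _ ow oz t2 tz).
have n1 z : other z -> z != v -> ~~ touch e1 z.
  by move=> oz; apply: contra => tz; rewrite (touch_inj _ _ _ ov oz t1 tz).
have nwv : w != v by rewrite eq_sym.
have [u [d [ud Eu Ed]]] := wt_touched R U e1 e2 v ov e1U e1R t1 (n2 _ ov nvw).
have [u' [d' [ud' Eu' Ed']]] :=
  wt_touched R U e2 e1 w ow e2U e2R t2 (n1 _ ow nwv).
exists u, d, u', d'; rewrite /pot.
have U12 : U :\ e2 :\ e1 = U :\ e1 :\ e2 by rewrite !setDDl setUC.
rewrite {}U12 in Eu' Ed'.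
have E e : e \in [set e1; e2] ->
    \prod_(z | other z && (z != v) && (z != w)) wt (e |: R) (U :\ e1 :\ e2) z =
    \prod_(z | other z && (z != v) && (z != w)) wt R U z.
  move=> He; apply: eq_bigr => z /andP[/andP[oz zv] zw].
  by apply: wt_untouched He; [exact: n1 | exact: n2].
have ow' : other w && (w != v) by rewrite ow.
rewrite !(bigD1 v ov) /= !(bigD1 w ow') /= !E ?set21 ?set22 //.
by rewrite Eu Ed Eu' Ed'; split=> //; ring.
Qed.

Lemma pot_ge0 R U : 0 <= pot R U.
Proof. by apply: prodr_ge0 => v _; apply: ltW (wt_gt0 R U v). Qed.

Lemma ratio_pair_potential (u d u' d' p : F) :
  ratio_pair u d -> ratio_pair u' d' -> 0 <= p ->
  2%:R * (u * d' * p) + d * u' * p <= 3%:R * p.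
Proof.
move=> ud ud' p0; rewrite mulrA -mulrDl ler_wpM2r //.
exact: ratio_pair_drift.
Qed.

(** This order does not mention the centres, so one biased rule serves all pairs at once: {a,v}
    comes before {b,v} exactly when a < b. *)
Definition rank e := (\sum_(i in e) i)%N.

Lemma rank_spoke (c v : 'I_n) : v != c -> rank [set c; v] = (c + v)%N.
Proof. by move=> nvc; rewrite /rank big_setU1 ?big_set1 // in_set1 eq_sym. Qed.

Lemma pot_drift R U e1 e2 : (a < b)%N -> [disjoint R & U] ->
  e1 \in U -> e2 \in U -> e1 != e2 -> (rank e1 <= rank e2)%N ->
  2%:R * pot (e1 |: R) (U :\ e1 :\ e2) + pot (e2 |: R) (U :\ e1 :\ e2)
    <= 3%:R * pot R U.
Proof.
move=> lt_ab dRU e1U e2U n12 le12.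
(* An offered edge that touches no vertex enters the drift inequality as the pair (1, 1). *)
have one : ratio_pair 1 1 by left.
have e1R : e1 \notin R by rewrite (disjointFl dRU).
have e2R : e2 \notin R by rewrite (disjointFl dRU).
have p0 := pot_ge0 R U.
case: (pickP (fun v => other v && touch e1 v)) => [v /andP[ov t1]|N1];
  case: (pickP (fun v => other v && touch e2 v)) => [w /andP[ow t2]|N2].
- have [vw|nvw] := eqVneq v w; last first.
    have [u [d [u' [d' [ud ud' -> ->]]]]] :=
      pot_touch2 R U e1 e2 v w ov ow e1U e1R e2U e2R nvw t1 t2.
    exact: ratio_pair_potential.
  subst w; have [va vb] := andP ov.
  (* Distinct edges touching the same v are its two spokes, and a + v < b + v decides which is
     [e1]. *)
  have [E1 E2] : e1 = [set a; v] /\ e2 = [set b; v].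
    case/orP: t1 n12 le12 => /eqP->; case/orP: t2 => /eqP->; rewrite ?eqxx //.
    by rewrite !rank_spoke // leq_add2r leqNgt lt_ab.
  subst e1 e2; rewrite /pot.
  have E e : e \in [set [set a; v]; [set b; v]] ->
      \prod_(z | other z && (z != v))
        wt (e |: R) (U :\ [set a; v] :\ [set b; v]) z =
      \prod_(z | other z && (z != v)) wt R U z.
    move=> He; apply: eq_bigr => z /andP[oz nzv]; apply: wt_untouched He.
      by apply: contra nzv => tz; rewrite (touch_inj _ _ _ ov oz t1 tz).
    by apply: contra nzv => tz; rewrite (touch_inj _ _ _ ov oz t2 tz).
  rewrite !(bigD1 v ov) !E ?set21 ?set22 // [2%:R * _]mulrA -mulrDl.
  rewrite [leRHS]mulrA ler_wpM2r //.
    by apply: prodr_ge0 => z _; apply: ltW (wt_gt0 R U z).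
  exact: wt_shared.
- have {}N2 w : other w -> ~~ touch e2 w.
    by move=> ow; move: (N2 w); rewrite ow /= => ->.
  have [u [d [ud -> ->]]] := pot_touch1 R U e1 e2 v ov e1U e1R t1 N2.
  by have := ratio_pair_potential u d 1 1 _ ud one p0; rewrite !mulr1.
- have {}N1 z : other z -> ~~ touch e1 z.
    by move=> oz; move: (N1 z); rewrite oz /= => ->.
  have [u [d [ud E2 E1]]] := pot_touch1 R U e2 e1 w ow e2U e2R t2 N1.
  have U12 : U :\ e2 :\ e1 = U :\ e1 :\ e2 by rewrite !setDDl setUC.
  rewrite U12 in E1 E2; rewrite E1 E2.
  by have := ratio_pair_potential 1 1 u d _ one ud p0; rewrite !mul1r.
- by apply: pot_drift0 => v ov; move: (N1 v) (N2 v); rewrite ov /= => -> ->.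
Qed.

(* A leaf of the larger centre b is worth 12 and a leaf of a at least 9, so two
   stars with 0.499n leaves are worth 10.479n, against 10n at the start. *)
Lemma pot_lower R U (La Lb : {set 'I_n}) : [disjoint R & U] ->
  {in La, forall v, other v} -> {in Lb, forall v, other v} ->
  has_star R a La -> has_star R b Lb -> [disjoint La & Lb] ->
  base ^+ (9 * #|La| + 12 * #|Lb|) <= pot R U.
Proof.
move=> dRU oA oB sA sB dAB.
pose f v : nat := (9 * (v \in La) + 12 * (v \in Lb))%N.
have -> : (9 * #|La| + 12 * #|Lb| = \sum_(v | other v) f v)%N.
  have E (L : {set 'I_n}) : {in L, forall v, other v} ->
      (\sum_(v | other v) (v \in L) = #|L|)%N.
    move=> oL; rewrite -sum1_card big_mkcond [RHS]big_mkcond.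
    apply: eq_bigr => v _; case vL: (v \in L); last by case: ifP.
    by rewrite (oL _ vL).
  by rewrite big_split /= -!big_distrr /= !E.
rewrite expr_sum; apply: ler_prod => v ov; rewrite exprn_ge0 ?(ltW base_gt0) //=.
apply: (@le_trans _ _ (base ^+ score ([set a; v] \in R) ([set a; v] \in U)
         ([set b; v] \in R) ([set b; v] \in U))); last first.
  by rewrite ler_peMr ?exprn_ge0 ?exprn_ege1 ?(ltW base_gt0) ?(ltW tax_gt1).
apply: ler_weXn2l; first exact: ltW base_gt1.
rewrite /f; have [vA|nA] := boolP (v \in La).
  rewrite (disjointFr dAB vA) (sA _ vA) (disjointFr dRU (sA _ vA)).
  by do 2!case: (_ \in _).
have [vB|nB] := boolP (v \in Lb); last by [].
rewrite (sB _ vB) (disjointFr dRU (sB _ vB)).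
by do 2!case: (_ \in _).
Qed.

Lemma pot_start U : pot set0 U <= base ^+ (10 * n) * tax ^+ (2 * n).
Proof.
have -> : base ^+ (10 * n) * tax ^+ (2 * n) =
    \prod_(v < n) (base ^+ 10 * tax ^+ 2).
  by rewrite big_const_ord iter_mulr_1 exprMn -!exprM.
have ge1 : 1 <= base ^+ 10 * tax ^+ 2.
  by rewrite mulr_ege1 // exprn_ege1 // ltW.
rewrite /pot big_mkcond; apply: ler_prod => v _.
case: ifP => _; last by rewrite ler01.
rewrite (ltW (wt_gt0 _ _ _)) /wt !in_set0 /=.
apply: ler_pM; rewrite ?exprn_ge0 ?(ltW base_gt0) ?(ltW tax_gt0) //.
  by apply: ler_weXn2l; rewrite ?(ltW base_gt1) ?(ltW tax_gt1) //;
    do 2!case: (_ \in _).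
by apply: ler_weXn2l; rewrite ?(ltW base_gt1) ?(ltW tax_gt1) //;
    do 2!case: (_ \in _).
Qed.

End Pair.

(** * Summation over pairs and Client's strategy *)

Definition Phi n (R U : {set {set 'I_n}}) : F :=
  \sum_(p : 'I_n * 'I_n | (p.1 < p.2)%N) pot n p.1 p.2 R U.

(** Derandomization: the mean of the two outcomes with weights 2/3 and 1/3 is at most the current
    value, so one outcome is too. *)
Lemma Phi_drift n (R U : {set {set 'I_n}}) (e1 e2 : {set 'I_n}) :
  [disjoint R & U] -> e1 \in U -> e2 \in U -> e1 != e2 ->
  (rank n e1 <= rank n e2)%N ->
  Phi n (e1 |: R) (U :\ e1 :\ e2) <= Phi n R U \/
  Phi n (e2 |: R) (U :\ e1 :\ e2) <= Phi n R U.
Proof.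
move=> dRU e1U e2U n12 le12.
have : 2%:R * Phi n (e1 |: R) (U :\ e1 :\ e2) + Phi n (e2 |: R) (U :\ e1 :\ e2)
    <= 3%:R * Phi n R U.
  rewrite /Phi !mulr_sumr -big_split; apply: ler_sum => p lt_p.
  by apply: pot_drift => //; rewrite -val_eqE neq_ltn lt_p.
case: (lerP (Phi n (e1 |: R) (U :\ e1 :\ e2)) (Phi n R U)) => [|gt1].
  by left.
by right; lra.
Qed.

Lemma client_keeps_Phi n (P : {set {set 'I_n}} -> Prop) (B : F) :
  (forall R U : {set {set 'I_n}}, R \subset Kedges n -> [disjoint R & U] ->
     Phi n R U <= B -> P R) ->
  forall R U : {set {set 'I_n}}, R \subset Kedges n -> U \subset Kedges n ->
    [disjoint R & U] -> Phi n R U <= B -> client_wins P R U.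
Proof.
move=> HP R U; have [k] := ubnP #|U|.
elim: k R U => // k IH R U ltUk RK UK dRU leB.
have [leU1|gtU1] := leqP #|U| 1; first by apply: cw_end => //; apply: HP leB.
apply: cw_step => // e1 e2 e1U e2U n12.
wlog le12 : e1 e2 e1U e2U n12 / (rank n e1 <= rank n e2)%N.
  move=> W; have [le|/ltnW le] := leqP (rank n e1) (rank n e2); first exact: W.
  have U21 : U :\ e2 :\ e1 = U :\ e1 :\ e2 by rewrite !setDDl setUC.
  have n21 : e2 != e1 by rewrite eq_sym.
  by have := W e2 e1 e2U e1U n21 le; rewrite U21 => -[]; [right | left].
have step e : e \in [set e1; e2] ->
    Phi n (e |: R) (U :\ e1 :\ e2) <= Phi n R U ->
    client_wins P (e |: R) (U :\ e1 :\ e2).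
  move=> He lePhi; have eU : e \in U.
    by move: He; rewrite in_set2 => /orP[] /eqP->.
  apply: IH; last exact: le_trans lePhi leB.
  - have n21 : e2 != e1 by rewrite eq_sym.
    move: ltUk; rewrite (cardsD1 e1) e1U (cardsD1 e2 (U :\ e1)) !inE n21 e2U.
    exact: ltnW.
  - by rewrite subUset sub1set RK (subsetP UK).
  - by rewrite !setDDl; apply: subset_trans UK; exact: subsetDl.
  - rewrite disjoints_subset subUset sub1set -disjoints_subset.
    apply/andP; split.
      by move: He; rewrite !inE => /orP[] /eqP->; rewrite eqxx ?andbF.
    by apply: disjointWr dRU; rewrite !setDDl; exact: subsetDl.
by have [le|le] := Phi_drift n R U e1 e2 dRU e1U e2U n12 le12; [left|right];
  apply: step => //; rewrite ?set21 ?set22.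
Qed.

(** * Comparison of the initial and final potential *)

Lemma Phi_start n (U : {set {set 'I_n}}) :
  Phi n set0 U <= (n ^ 2)%:R * (base ^+ (10 * n) * tax ^+ (2 * n)).
Proof.
have B0 : 0 <= base ^+ (10 * n) * tax ^+ (2 * n).
  by rewrite mulr_ge0 ?exprn_ge0 ?(ltW base_gt0) ?(ltW tax_gt0).
apply: (@le_trans _ _ (\sum_(p : 'I_n * 'I_n)
  base ^+ (10 * n) * tax ^+ (2 * n))).
  rewrite /Phi big_mkcond; apply: ler_sum => p _; case: ifP => // _.
  exact: pot_start.
by rewrite sumr_const card_prod card_ord mulr_natl.
Qed.

Lemma Phi_big_stars n (R U : {set {set 'I_n}}) : R \subset Kedges n ->
  [disjoint R & U] -> two_disjoint_big_stars R ->
  exists2 S : nat, (1047 * n <= 100 * S)%N & base ^+ S <= Phi n R U.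
Proof.
move=> RK dRU [c1 [c2 [L1 [L2 [s1 s2 d12 big1 big2]]]]].
(* A leaf equal to its centre would give the singleton {c}, which is no edge. *)
have irr (c : 'I_n) L : has_star R c L -> c \notin L.
  move=> sL; apply/negP => /sL /(subsetP RK).
  by rewrite inE setUid cards1.
wlog lt12 : c1 c2 L1 L2 s1 s2 d12 big1 big2 / (c1 < c2)%N.
  move=> W; have [lt12|lt21|eq12] := ltngtP c1 c2.
  - exact: (W c1 c2 L1 L2).
  - by apply: (W c2 c1 L2 L1) => //; rewrite disjoint_sym.
  - by have := disjointFr d12 (setU11 c1 L1); rewrite (val_inj eq12) setU11.
have dL : [disjoint L1 & L2].
  by apply: disjointW d12; exact: subsetUr.
have c1L2 : c1 \notin L2.
  by apply/negP => H; have := disjointFr d12 (setU11 c1 L1);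
    rewrite !inE H orbT.
have c2L1 : c2 \notin L1.
  by apply/negP => H; have := disjointFl d12 (setU11 c2 L2);
    rewrite !inE H orbT.
exists (9 * #|L1| + 12 * #|L2|)%N.
  (* (9 + 12) * 0.499 = 10.479, rounded down to 10.47. *)
  by clear -big1 big2; lia.
apply: (@le_trans _ _ (pot n c1 c2 R U)).
  apply: pot_lower => // v vL; rewrite /other.
  - apply/andP; split; first by apply: contraNneq (irr _ _ s1) => <-.
    by apply: contraNneq c2L1 => <-.
  - apply/andP; split; first by apply: contraNneq c1L2 => <-.
    by apply: contraNneq (irr _ _ s2) => <-.
rewrite /Phi (bigD1 (c1, c2)) //= lerDl; apply: sumr_ge0 => p _.
exact: pot_ge0.
Qed.

Hypothesis tax_base : tax ^+ 10 < base ^+ 2.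

(** The surplus m = S - 10n is at least 0.47n, hence at least 2n/5. After taking fifth powers, it
    suffices that n^10 * tax^(10n) < base^(2n), which is exponential growth of
    [base ^+ 2 / tax ^+ 10] against degree 10. *)
Lemma potential_gap : exists n0, forall n S : nat, (n0 <= n)%N ->
  (1047 * n <= 100 * S)%N ->
  (n ^ 2)%:R * (base ^+ (10 * n) * tax ^+ (2 * n)) < base ^+ S.
Proof.
have t0 : 0 < tax ^+ 10 by rewrite exprn_gt0 ?tax_gt0.
have gt1 : 1 < base ^+ 2 / tax ^+ 10 by rewrite ltr_pdivlMr ?mul1r.
have [N HN] := expn_lt_expr F _ 10 gt1.
exists N => n S leNn leS.
have [m Em] : exists m, S = (10 * n + m)%N by exists (S - 10 * n)%N; lia.
have lem : (2 * n <= 5 * m)%N by lia.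
rewrite Em exprD mulrCA ltr_pM2l ?exprn_gt0 ?base_gt0 //.
have nn k : 0 <= base ^+ k by rewrite exprn_ge0 ?(ltW base_gt0).
have tn k : 0 <= tax ^+ k by rewrite exprn_ge0 ?(ltW tax_gt0).
rewrite -(@ltr_pXn2r _ 5) ?nnegrE ?mulr_ge0 ?ler0n //.
apply: (@lt_le_trans _ _ (base ^+ (2 * n))); last first.
  by rewrite -exprM; apply: ler_weXn2l; [exact: ltW | lia].
have := HN n leNn; rewrite expr_div_n ltr_pdivlMr ?exprn_gt0 ?tax_gt0 //.
rewrite [(_%:R * _) ^+ 5]exprMn -natrX -expnM -!exprM.
by have -> : (2 * n * 5 = 10 * n)%N by lia.
Qed.

Lemma client_wins_big : exists n0, forall n, (n0 <= n)%N ->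
  client_wins (fun R : {set {set 'I_n}} => ~ two_disjoint_big_stars R)
              set0 (Kedges n).
Proof.
have [n0 gap] := potential_gap; exists n0 => n len.
apply: (client_keeps_Phi _ _ (Phi n set0 (Kedges n))) => //.
- move=> R U RK dRU lePhi /(Phi_big_stars _ _ _ RK dRU) [S leS lePhi'].
  have := gap n S len leS; rewrite ltNge => /negP[].
  exact: le_trans lePhi' (le_trans lePhi (Phi_start _ _)).
- exact: sub0set.
- by rewrite disjoints_subset sub0set.
Qed.

End Potential.

(** * Numerical values of the parameters *)

Lemma params_drift (u d u' d' : rat) :
  ratio_pair rat (201%:R / 200%:R) (2001%:R / 2000%:R) u d ->
  ratio_pair rat (201%:R / 200%:R) (2001%:R / 2000%:R) u' d' ->
  2%:R * (u * d') + d * u' <= 3%:R.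
Proof.
have E c : (c <= 4)%N -> [|| c == 0, c == 1, c == 2, c == 3 | c == 4]%N.
  by case: c => [|[|[|[|[|]]]]].
case=> [[-> ->]|[c /E Ec [-> ->]]]; case=> [[-> ->]|[c' /E Ec' [-> ->]]].
- by lra.
- by case/or4P: Ec' => [/eqP->|/eqP->|/eqP->|/orP[/eqP->|/eqP->]]; lra.
- by case/or4P: Ec => [/eqP->|/eqP->|/eqP->|/orP[/eqP->|/eqP->]]; lra.
- by case/or4P: Ec => [/eqP->|/eqP->|/eqP->|/orP[/eqP->|/eqP->]];
  case/or4P: Ec' => [/eqP->|/eqP->|/eqP->|/orP[/eqP->|/eqP->]]; lra.
Qed.

Local Close Scope ring_scope.

Theorem theorem5p1 :
  exists n0 : nat, forall n : nat, n0 <= n ->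
    client_wins (fun R : {set {set 'I_n}} => ~ two_disjoint_big_stars R)
                set0 (Kedges n).
Proof.
(* Put h = base - 1 = 1/200. The second-order cost of a lone spoke is about h^2 * c^2, at most 16 *
   h^2 = 1/2500, below tax - 1 = 1/2000; [tax_base] asks roughly for tax - 1 < h/5 = 1/1000. *)
apply: (client_wins_big rat (201%:R / 200%:R)%R (2001%:R / 2000%:R)%R).
- by lra.
- by lra.
- exact: params_drift.
- by lra.
- by lra.
Qed.
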